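(* Let $X=\mathbb{C}^n$ with the standard flat metric $g=\frac12\sum_i(dz_i\otimes d\bar z_i+d\bar z_i\otimes dz_i)$, and let $f\in\mathbb{C}[z_1,\dots,z_n]$ be a quasi-homogeneous polynomial with an isolated critical point and all weights $q_i\le\frac12$. Then $(X,g,f)$ satisfies the strongly elliptic condition: for every $\epsilon>0$ and every integer $k\ge2$, $$\epsilon|\nabla f(z)|^k-|\nabla^kf(z)|\to+\infty\quad\text{as } z\to\infty .$$
   Context: $f$ is quasi-homogeneous if there are rational numbers (weights) $q_1,\dots,q_n\in\mathbb{Q}\cap(0,1)$ with $f(\lambda^{q_1}z_1,\dots,\lambda^{q_n}z_n)=\lambda f(z_1,\dots,z_n)$ for all $\lambda\in\mathbb{C}^*$. $\nabla$ is the Levi-Civita connection of $g$ (here the flat connection, so $\nabla^kf$ is the tensor of $k$-th order partial derivatives) and $|\cdot|$ is the pointwise norm induced by $g$. *)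

(* Defs.v *)
From HB Require Import structures.
From mathcomp Require Import all_boot all_order all_algebra.
From mathcomp Require Export complex.
(* mpoly must be imported before the analysis files: their notations only
   cohabit in this order. *)
From mathcomp Require Export mpoly.
From mathcomp Require Export classical_sets filter reals topology normedtype.
From mathcomp Require Export sequences trigo.

Set Implicit Arguments.
Unset Strict Implicit.
Unset Printing Implicit Defensive.

Import Order.TTheory GRing.Theory Num.Theory.
Import numFieldNormedType.Exports.

Local Open Scope ring_scope.
Local Open Scope complex_scope.
Local Open Scope classical_set_scope.

Section Defs.
Variables (R : realType) (n : nat).
Implicit Types (z : 'rV[R[i]]_n) (f : {mpoly R[i][n]}) (q : 'I_n -> rat).

Definition cexp (w : R[i]) : R[i] :=
  (expR (complex.Re w) * cos (complex.Im w)) +i* (expR (complex.Re w) * sin (complex.Im w)).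

(* The powers lambda^(q_i) are exp (q_i * w), where w is a logarithm of lambda
   common to all the coordinates. Which logarithm is used does not matter, since
   the condition says that sum_i q_i m_i = 1 for all exponents m of f. *)
Definition quasi_homogeneous q f : Prop :=
  (forall i, 0 < q i < 1) /\
  (forall lambda : R[i], lambda != 0 ->
   forall w : R[i], cexp w = lambda ->
   forall z, f.@[fun i => cexp (ratr (q i) * w) * z 0 i] = lambda * f.@[z 0]).

Definition enorm z : R := Num.sqrt (\sum_i (Normc.normc (z 0 i)) ^+ 2).

Definition critical_point f z : Prop := forall i, (f^`M(i)).@[z 0] = 0.

Definition isolated_critical_point f z : Prop :=
  critical_point f z /\
  exists2 r : R, 0 < r &
    forall z', 0 < enorm (z' - z) < r -> ~ critical_point f z'.

(* A complexified tangent vector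
     sum_i (v.1_i d/dz_i + v.2_i d/d(conj z_i))
   is the pair of its (1,0) and (0,1) components; this is
   g = 1/2 sum_i (dz_i (x) d(conj z_i) + d(conj z_i) (x) dz_i),
   extended complex bilinearly. *)
Definition flat_metric (v w : 'rV[R[i]]_n * 'rV[R[i]]_n) : R[i] :=
  2^-1 * \sum_i (v.1 0 i * w.2 0 i + v.2 0 i * w.1 0 i).

(* g_(i, conj j) = g (d/dz_i, d/d(conj z_j)), and its inverse *)
Definition metric_mx : 'M[R[i]]_n :=
  \matrix_(i, j) flat_metric (delta_mx 0 i, 0) (0, delta_mx 0 j).

Definition cometric_mx : 'M[R[i]]_n := invmx metric_mx.

(* Norm induced by g on a tensor sum_I T_I dz_(I_1) (x) ... (x) dz_(I_k):
     |T|^2 = sum_(I, J) g^(I_1, conj J_1) ... g^(I_k, conj J_k) T_I conj(T_J). *)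
Definition tensor_norm k (T : k.-tuple 'I_n -> R[i]) : R :=
  Num.sqrt (complex.Re (\sum_(I : k.-tuple 'I_n) \sum_(J : k.-tuple 'I_n)
    (\prod_(a < k) cometric_mx (tnth I a) (tnth J a)) * T I * (T J)^*)).

(* g is flat and f is holomorphic: the components of nabla^k f in the frame dz_i
   are the k-th partial derivatives of f, and the components involving some
   d(conj z_i) vanish. *)
Definition nabla k f z (I : k.-tuple 'I_n) : R[i] := (foldr (@mderiv n R[i]) f I).@[z 0].

Definition at_infinity : set_system 'rV[R[i]]_n :=
  filter_from [set: R] (fun M => [set z | M < enorm z]).

Definition strongly_elliptic f : Prop :=
  forall eps : R, 0 < eps -> forall k : nat, (2 <= k)%N ->
    (eps * tensor_norm (@nabla 1 f z) ^+ k - tensor_norm (@nabla k f z))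
      @[z --> at_infinity] --> +oo.

End Defs.

(* Main.v *)
(* After clearing denominators the weights are q_i = d_i / 2E with
   0 < d_i <= E, and every z <> 0 can be written z_i = s^(d_i) u_i with
   max |u_i| = 1, where s = max |z_i|^(1/d_i). The gradient has no zero besides
   the origin, since any other zero would produce a curve of zeros
   accumulating at the isolated critical point. By compactness it is bounded
   below on {max |u_i| = 1}, so that |nabla f(z)| >= c s^E for s >= 1. On the
   other hand d^I f is weighted homogeneous of degree 2E - \sum_(i in I) d_i,
   hence |nabla^k f(z)| <= C s^(2E - 1), which is negligible with respect to
   s^(kE) as soon as k >= 2. *)
Require Import Defs.
From mathcomp Require Import all_boot all_order all_algebra.
From mathcomp Require Import boolp exp derive.
Import Order.TTheory GRing.Theory Num.Theory.
Import numFieldNormedType.Exports.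
Import Normc.
Set Implicit Arguments.
Unset Strict Implicit.
Unset Printing Implicit Defensive.

Local Open Scope ring_scope.
Local Open Scope complex_scope.
Local Open Scope classical_set_scope.

(** * Polynomials vanishing at every point *)

(** Reduction modulo [B] isolates the lowest digit; cancelling it together with one factor [B]
    leaves the induction hypothesis. *)
Lemma base_expansion_inj (B n : nat) (a b : 'I_n -> nat) :
  (forall i, a i < B)%N -> (forall i, b i < B)%N ->
  (\sum_i a i * B ^ i = \sum_i b i * B ^ i)%N -> a =1 b.
Proof.
elim: n a b => [|n IH] a b aB bB; first by move=> _ [].
have B_gt0 : (0 < B)%N := leq_ltn_trans (leq0n _) (aB ord0).
have split (c : 'I_n.+1 -> nat) : (\sum_i c i * B ^ i =
    c ord0 + (\sum_(i < n) c (lift ord0 i) * B ^ i) * B)%N.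
  rewrite big_ord_recl expn0 muln1 big_distrl /=; congr (_ + _)%N.
  by apply: eq_bigr => i _; rewrite /= /bump /= expnSr mulnA.
rewrite !split => ab.
have a0 : a ord0 = b ord0.
  have := congr1 (modn^~ B) ab.
  by rewrite /= ![(_ ord0 + _)%N]addnC !modnMDl !modn_small.
move/eqP: ab; rewrite a0 eqn_add2l eqn_pmul2r // => /eqP/IH ab i.
case: (unliftP ord0 i) => [j ->|->//].
exact: ab.
Qed.

Lemma poly_eq0_horner (F : numDomainType) (p : {poly F}) :
  (forall x, p.[x] = 0) -> p = 0.
Proof.
move=> p0; apply: (@roots_geq_poly_eq0 _ p [seq k%:R | k <- iota 0 (size p)]).
- by apply/allP => x _; apply/rootP.
- by rewrite map_inj_uniq ?iota_uniq // => i j /eqP; rewrite eqr_nat => /eqP.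
- by rewrite size_map size_iota.
Qed.

(* Kronecker substitution: with B larger than every exponent, x_i = y^(B^i)
   sends distinct monomials of p to distinct powers of y. *)
Lemma mpoly_eq0_meval (F : numDomainType) n (p : {mpoly F[n]}) :
  (forall v, p.@[v] = 0) -> p = 0.
Proof.
move=> p0; set B := msize p.
pose kr (m : 'X_{1..n}) := (\sum_i m i * B ^ i)%N.
have P0 : \sum_(m <- msupp p) p@_m *: 'X^(kr m) = 0 :> {poly F}.
  apply: poly_eq0_horner => x; rewrite -[RHS](p0 (fun i => x ^+ (B ^ i))).
  rewrite mevalE horner_sum; apply: eq_bigr => m _.
  rewrite hornerZ hornerXn -prodrXr; congr (_ * _).
  by apply: eq_bigr => i _; rewrite -exprM mulnC.
(* For nonzero [p], [msize p] is one more than the total degree, hence the strict bound required of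
   base [B] digits. *)
have mB (m : 'X_{1..n}) i : m \in msupp p -> (m i < B)%N.
  move=> /msize_mdeg_lt; apply: leq_ltn_trans.
  by rewrite mdegE (bigD1 i) //= leq_addr.
apply/mpolyP => m; rewrite mcoeff0.
have [mp|/memN_msupp_eq0 //] := boolP (m \in msupp p).
have := congr1 (fun P : {poly F} => P`_(kr m)) P0.
rewrite coef0 coef_sum (bigD1_seq m) ?msupp_uniq //= coefZ coefXn eqxx mulr1.
rewrite big_seq_cond big1 ?addr0 // => m' /andP[m'p m'm].
rewrite coefZ coefXn; case: eqP => [e|]; last by rewrite mulr0.
case/eqP: m'm; apply/mnmP => i; apply/esym; move: i.
by apply: base_expansion_inj e => i; exact: mB.
Qed.

(** * Weighted homogeneous polynomials *)

Definition weighted_deg n (d : 'I_n -> nat) (m : 'X_{1..n}) : nat :=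
  (\sum_i d i * m i)%N.

(* Weighted homogeneity of degree D - e, with e on the left to avoid
   truncated subtraction: a nonzero p requires e <= D. *)
Definition weighted_homog (F : numDomainType) n (d : 'I_n -> nat) (D e : nat)
  (p : {mpoly F[n]}) : Prop :=
  forall m, m \in msupp p -> (weighted_deg d m + e = D)%N.

Lemma weighted_homog_meval (F : numDomainType) n (d : 'I_n -> nat) D e
    (p : {mpoly F[n]}) (s : F) (u : 'I_n -> F) :
  weighted_homog d D e p ->
  p.@[fun i => s ^+ d i * u i] * s ^+ e = s ^+ D * p.@[u].
Proof.
move=> ph; rewrite !mevalE mulr_suml mulr_sumr big_seq [RHS]big_seq.
apply: eq_bigr => m /ph <-; rewrite exprD.
under eq_bigr do rewrite exprMn -exprM.
rewrite big_split /= prodrXr -/(weighted_deg d m).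
by rewrite [p@_m * _]mulrCA mulrAC.
Qed.

(** A monomial [m] of the derivative comes from the monomial of [p] with one more factor $x_i$,
    whose weighted degree is larger by [d i]. *)
Lemma weighted_homog_mderiv (F : numDomainType) n (d : 'I_n -> nat) D e
    (p : {mpoly F[n]}) i :
  weighted_homog d D e p -> weighted_homog d D (e + d i) p^`M(i).
Proof.
move=> ph m; rewrite mcoeff_msupp mcoeff_deriv mulrn_eq0 /= -mcoeff_msupp.
move=> /ph <-; rewrite addnA addnAC; congr (_ + _)%N.
rewrite /weighted_deg; under [RHS]eq_bigr do rewrite mnmDE mulnDr.
rewrite big_split /= [X in (_ = _ + X)%N](bigD1 i) //= mnmE eqxx muln1.
rewrite [X in (_ = _ + (_ + X))%N]big1 ?addn0 // => j ji.
by rewrite mnmE eq_sym (negPf ji) muln0.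
Qed.

Lemma weighted_homog_mderivs (F : numDomainType) n (d : 'I_n -> nat) D e
    (p : {mpoly F[n]}) (I : seq 'I_n) :
  weighted_homog d D e p ->
  weighted_homog d D (e + \sum_(i <- I) d i) (foldr (@mderiv n F) p I).
Proof.
move=> ph; elim: I => [|i I IH]; first by rewrite big_nil addn0.
by rewrite big_cons /= addnCA addnC; exact: weighted_homog_mderiv.
Qed.

(** * Integer weights and weighted homogeneity of [f] *)

(** [E] is the product of the denominators; with [2 * E] as common denominator, the condition
    $q_i\le\frac12$ reads $d_i\le E$. *)
Lemma common_even_denominator n (q : 'I_n -> rat) :
  (forall i, 0 < q i) -> (forall i, q i <= 2^-1) ->
  exists E (d : 'I_n -> nat), [/\ (0 < E)%N, forall i, (0 < d i <= E)%N
    & forall i, q i * (2 * E)%:R = (d i)%:R].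
Proof.
move=> q0 q2; pose E := (\prod_i `|denq (q i)|)%N.
have E0 : (0 < E)%N by apply: prodn_gt0 => i; rewrite absz_gt0 denq_neq0.
pose d i := (2 * (`|numq (q i)| * \prod_(j | j != i) `|denq (q j)|))%N.
have qd i : q i * (2 * E)%:R = (d i)%:R.
  rewrite /d /E (bigD1 i) //= !natrM mulrCA; congr (_ * _).
  rewrite mulrA; congr (_ * _).
  rewrite -[X in X * _]divq_num_den !pmulrn absz_denq.
  by rewrite mulfVK ?intr_eq0 ?denq_neq0 // gez0_abs // ltW // numq_gt0.
exists E, d; split=> // i; rewrite -(ltr0n rat) -(ler_nat rat) -qd.
rewrite mulr_gt0 ?ltr0n ?muln_gt0 //=.
rewrite natrM mulrA ler_piMl ?ler0n //.
by rewrite -ler_pdivlMr ?mul1r.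
Qed.

Lemma normc_ge0 (R : rcfType) (x : R[i]) : 0 <= normc x.
Proof. by case: x => a b; exact: sqrtr_ge0. Qed.

Lemma normcX (R : rcfType) (x : R[i]) k : normc (x ^+ k) = normc x ^+ k.
Proof. by elim: k => [|k IH]; rewrite ?normc1 // !exprS normcM IH. Qed.

Lemma normc_real (R : rcfType) (x : R) : normc x%:C = `|x|.
Proof. by rewrite /= expr0n addr0 sqrtr_sqr. Qed.

Lemma sqr_normcE (R : rcfType) (x : R[i]) :
  normc x ^+ 2 = complex.Re x ^+ 2 + complex.Im x ^+ 2.
Proof. by case: x => a b; rewrite /= sqr_sqrtr // addr_ge0 ?sqr_ge0. Qed.

Lemma normc_eq0 (R : rcfType) (x : R[i]) : (normc x == 0) = (x == 0).
Proof.
by apply/eqP/eqP => [/eq0_normc //|->]; exact: normc0.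
Qed.

Lemma cexp_real (R : realType) (x : R) : cexp x%:C = (expR x)%:C.
Proof. by rewrite /cexp /= cos0 sin0 mulr1 mulr0. Qed.

(** The single value $\lambda=2^D$ with logarithm $D\ln 2$ suffices: the powers $\lambda^{q_i}$
    become the integers $2^{d_i}$, and distinct weighted degrees are told apart by distinct powers
    of 2. *)
Lemma quasi_homogeneous_weighted (R : realType) n (q : 'I_n -> rat)
    (d : 'I_n -> nat) D (f : {mpoly R[i][n]}) :
  (forall i, q i * D%:R = (d i)%:R) ->
  quasi_homogeneous q f -> weighted_homog d D 0 f.
Proof.
move=> qd [_ qh].
have expk k : cexp (k%:R * (ln 2)%:C) = 2 ^+ k :> R[i].
  rewrite -(rmorph_nat (real_complex R)) -rmorphM cexp_real.
  by rewrite expRM_natl lnK ?posrE // rmorphXn rmorph_nat.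
have f2 z : f.@[fun i => 2 ^+ d i * z i] = 2 ^+ D * f.@[z].
  have two_neq0 : (2 ^+ D : R[i]) != 0 by rewrite expf_neq0 ?pnatr_eq0.
  have h := qh _ two_neq0 _ (expk D) (\row_i z i).
  have -> : f.@[z] = f.@[(\row_i z i) 0] by apply: meval_eq => i; rewrite mxE.
  rewrite -h; apply: meval_eq => i; rewrite mxE; congr (_ * _).
  have qdi : ratr (q i) * D%:R = (d i)%:R :> R[i].
    by rewrite -(ratr_nat R[i] D) -rmorphM qd /= ratr_nat.
  by rewrite mulrA qdi expk.
(* This is $f(2^{d_1}z_1,\dots,2^{d_n}z_n)-2^Df(z)$ expanded on monomials; its coefficients vanish
   because it vanishes at every point. *)
pose g := \sum_(m <- msupp f) (f@_m * (2 ^+ weighted_deg d m - 2 ^+ D)) *: 'X_[m].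
have g0 : g = 0.
  apply: mpoly_eq0_meval => z; move/eqP: (f2 z).
  rewrite -subr_eq0 => /eqP; rewrite !(mevalE _ f) mulr_sumr -sumrB => <-.
  rewrite /g raddf_sum.
  apply: eq_bigr => m _; rewrite /= mevalZ mevalX.
  under [in RHS]eq_bigr do rewrite exprMn -exprM.
  rewrite big_split /= prodrXr -/(weighted_deg d m).
  by rewrite mulrBr mulrBl -!mulrA [2 ^+ D * (f@_m * _)]mulrCA.
move=> m mf; rewrite addn0; have := congr1 (mcoeff m) g0.
rewrite mcoeff0 raddf_sum /= (bigD1_seq m) ?msupp_uniq //= big_seq_cond big1.
  rewrite addr0 mcoeffZ mcoeffX eqxx mulr1 => /eqP.
  rewrite mulf_eq0 -[f@_m == 0]negbK -mcoeff_msupp mf /= subr_eq0.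
  by move=> /eqP/ieexprIn -> //; rewrite ?pnatr_eq1.
by move=> m' /andP[_ m'm]; rewrite mcoeffZ mcoeffX (negPf m'm) mulr0.
Qed.

(** * Polydisc bounds, weighted scaling and compactness *)

Lemma meval_bound (R : rcfType) n (p : {mpoly R[i][n]}) :
  exists C, forall u, (forall i, normc (u i) <= 1) -> normc p.@[u] <= C.
Proof.
elim/mpolyind: p => [|c m p _ _ [C pC]].
  by exists 0 => u _; rewrite meval0 normc0.
exists (normc c + C) => u u1; rewrite mevalD mevalZ mevalX.
apply: le_trans (le_normcD _ _) _; apply: lerD; last exact: pC.
rewrite normcM ler_piMr ?normc_ge0 //.
apply: (big_ind (fun x => normc x <= 1)); first by rewrite normc1.
  by move=> x y x1 y1; rewrite normcM mulr_ile1 ?normc_ge0.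
by move=> i _; rewrite normcX exprn_ile1 ?normc_ge0.
Qed.

Lemma weighted_scaling (R : realType) n (d : 'I_n -> nat) (z : 'I_n -> R[i]) :
  (forall i, 0 < d i)%N -> (exists i, z i != 0) ->
  exists s (u : 'I_n -> R[i]), [/\ 0 < s, forall i, z i = s%:C ^+ d i * u i,
    forall i, normc (u i) <= 1 & exists i, normc (u i) = 1].
Proof.
move=> d0 [i0 zi0].
pose r i := normc (z i) `^ (d i)%:R^-1.
have rX i : r i ^+ d i = normc (z i).
  rewrite -powR_mulrn ?powR_ge0 // -powRrM mulVf ?pnatr_eq0 -?lt0n //.
  by rewrite powRr1 ?normc_ge0.
(* The scale is the largest [r i]: all the quotients [r i / r j] are then at most 1, with equality
   at [j]. *)
have [j rj] : exists j, forall i, r i <= r j.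
  by case: (@Order.TotalTheory.arg_maxP _ _ _ i0 xpredT r isT) => j _ rj; exists j => i; exact: rj.
have rj0 : 0 < r j.
  apply: lt_le_trans (rj i0); rewrite powR_gt0 // lt_neqAle normc_ge0 andbT.
  by rewrite eq_sym normc_eq0.
have s0 : (r j)%:C != 0 by rewrite (fmorph_eq0 (real_complex R)) gt_eqF.
exists (r j), (fun i => z i / (r j)%:C ^+ d i).
have normu i : normc (z i / (r j)%:C ^+ d i) = (r i / r j) ^+ d i.
  by rewrite normcM normcV normcX normc_real gtr0_norm // expr_div_n rX.
split=> // [i|i|].
- by rewrite mulrC divfK // expf_neq0.
- by rewrite normu exprn_ile1 ?divr_ge0 ?powR_ge0 // ler_pdivrMr ?mul1r.
- by exists j; rewrite normu divff ?gt_eqF // expr1n.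
Qed.

(* Stated on real and imaginary parts, to stay within the topology of R. *)
Definition ccontinuous (R : realType) (T : topologicalType) (F : T -> R[i]) :=
  continuous (fun t => complex.Re (F t)) /\
  continuous (fun t => complex.Im (F t)).

Lemma ccontinuous_cst (R : realType) (T : topologicalType) (c : R[i]) :
  ccontinuous (fun _ : T => c).
Proof. by split; exact: cst_continuous. Qed.

Lemma ccontinuousD (R : realType) (T : topologicalType) (F G : T -> R[i]) :
  ccontinuous F -> ccontinuous G -> ccontinuous (fun t => F t + G t).
Proof.
move=> [rF iF] [rG iG]; split => t.
  rewrite (_ : (fun t => _) = (fun t => complex.Re (F t)) \+ (fun t => complex.Re (G t))).
    exact: continuousD (rF t) (rG t).
  by apply/funext => x /=; case: (F x) (G x) => ? ? [].
rewrite (_ : (fun t => _) = (fun t => complex.Im (F t)) \+ (fun t => complex.Im (G t))).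
  exact: continuousD (iF t) (iG t).
by apply/funext => x /=; case: (F x) (G x) => ? ? [].
Qed.

Lemma ccontinuousM (R : realType) (T : topologicalType) (F G : T -> R[i]) :
  ccontinuous F -> ccontinuous G -> ccontinuous (fun t => F t * G t).
Proof.
move=> [rF iF] [rG iG]; split => t.
  rewrite (_ : (fun t => _) = (fun t => complex.Re (F t) * complex.Re (G t) -
     complex.Im (F t) * complex.Im (G t))).
    apply: cvgB; apply: cvgM;
      solve [exact: rF | exact: rG | exact: iF | exact: iG].
  by apply/funext => x /=; case: (F x) (G x) => ? ? [].
rewrite (_ : (fun t => _) = (fun t => complex.Re (F t) * complex.Im (G t) +
     complex.Im (F t) * complex.Re (G t))).
  apply: cvgD; apply: cvgM;
      solve [exact: rF | exact: rG | exact: iF | exact: iG].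
by apply/funext => x /=; case: (F x) (G x) => ? ? [].
Qed.

Lemma ccontinuous_prod (R : realType) (T : topologicalType) (I : finType)
    (F : I -> T -> R[i]) :
  (forall i, ccontinuous (F i)) -> ccontinuous (fun t => \prod_i F i t).
Proof.
move=> cF; elim: (index_enum I) => [|i r IH].
  by under eq_fun do rewrite big_nil; exact: ccontinuous_cst.
by under eq_fun do rewrite big_cons; exact: ccontinuousM.
Qed.

Lemma ccontinuous_meval (R : realType) (T : topologicalType) n
    (v : 'I_n -> T -> R[i]) (p : {mpoly R[i][n]}) :
  (forall i, ccontinuous (v i)) -> ccontinuous (fun t => p.@[v^~ t]).
Proof.
move=> cv; elim/mpolyind: p => [|c m p _ _ cp].
  by under eq_fun do rewrite meval0; exact: ccontinuous_cst.
under eq_fun do rewrite mevalD mevalZ mevalX.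
apply: ccontinuousD => //; apply: ccontinuousM; first exact: ccontinuous_cst.
apply: ccontinuous_prod => i; elim: (m i) => [|k IH].
  by under eq_fun do rewrite expr0; exact: ccontinuous_cst.
by under eq_fun do rewrite exprS; exact: ccontinuousM.
Qed.

Lemma continuous_sqr_normc (R : realType) (T : topologicalType) (F : T -> R[i]) :
  ccontinuous F -> continuous (fun t => normc (F t) ^+ 2).
Proof.
move=> [rF iF]; under eq_fun do rewrite sqr_normcE !expr2.
by move=> t; apply: cvgD; apply: cvgM; solve [exact: rF | exact: iF].
Qed.

Lemma continuous_sum_sqr_normc (R : realType) (T : topologicalType) (I : finType)
    (F : I -> T -> R[i]) :
  (forall i, ccontinuous (F i)) ->
  continuous (fun t => \sum_i normc (F i t) ^+ 2).
Proof.
move=> cF; elim: (index_enum I) => [|i r IH].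
  by under eq_fun do rewrite big_nil; exact: cst_continuous.
under eq_fun do rewrite big_cons.
by move=> t; apply: cvgD; [exact: continuous_sqr_normc|exact: IH].
Qed.

(* The polydisc boundary is relaxed to the compact set
   [|u_i| <= 1, \sum_i |u_i|^2 >= 1], which still avoids the origin. *)
Lemma common_zero_lower_bound (R : realType) n (I : finType)
    (p : I -> {mpoly R[i][n]}) :
  (forall u, (forall i, (p i).@[u] = 0) -> forall j, u j = 0) ->
  exists2 c : R, 0 < c & forall u : 'I_n -> R[i],
    (forall i, normc (u i) <= 1) -> (exists i, normc (u i) = 1) ->
    c <= \sum_i normc (p i).@[u] ^+ 2.
Proof.
(* $\mathbb{C}^n$ is identified with $\mathbb{R}^{2n}$, where closed bounded sets are compact and
   continuous real functions attain their minimum. *)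
move=> pz; pose v j (x : 'rV[R]_(n + n)) := x 0 (lshift n j) +i* x 0 (rshift n j).
have cv j : ccontinuous (v j) by split; exact: coord_continuous.
pose w (u : 'I_n -> R[i]) : 'rV[R]_(n + n) :=
  row_mx (\row_j complex.Re (u j)) (\row_j complex.Im (u j)).
have vw u j : v j (w u) = u j.
  by rewrite /v /w row_mxEl row_mxEr !mxE; case: (u j).
pose S := [set x | forall j, normc (v j x) ^+ 2 <= 1] `&`
          [set x | 1 <= \sum_j normc (v j x) ^+ 2].
have wS u : (forall i, normc (u i) <= 1) -> (exists i, normc (u i) = 1) -> S (w u).
  move=> u1 [j uj]; split => [i|]; rewrite /mkset; first by rewrite vw exprn_ile1 ?normc_ge0.
  rewrite (bigD1 j) // vw uj expr1n lerDl sumr_ge0 // => i _.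
  by rewrite exprn_ge0 ?normc_ge0.
have closedS : topology_structure.closed S.
  apply: closedI.
    rewrite (_ : [set x | _] = \bigcap_j [set x | normc (v j x) ^+ 2 <= 1]); last first.
      by apply/seteqP; split => x h j; [move=> _|]; exact: h.
    apply: closed_bigI => j _.
    apply: (preimage_closed _ (@closed_le R 1)).
    by move=> x _; exact: continuous_sqr_normc.
  apply: (preimage_closed _ (@closed_ge R 1)) => x _.
  exact: continuous_sum_sqr_normc.
have compactS : compact S.
  apply: bounded_closed_compact => //.
  exists 1; split => // M M1 x [x1 _].
  rewrite /Num.Def.normr /= mx_normrE; apply: bigmax_le => [|[i0 i] _].
    exact: le_trans ler01 (ltW M1).
  apply: le_trans (ltW M1); rewrite /= (ord1 i0) -(expr_le1 (n:=2)) //.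
  rewrite -normrX ger0_norm ?sqr_ge0 //.
  case: (fintype.splitP i) => j ij.
    have -> : i = lshift n j by apply: val_inj.
    by apply: le_trans (x1 j); rewrite sqr_normcE /= lerDl sqr_ge0.
  have -> : i = rshift n j by apply: val_inj.
  by apply: le_trans (x1 j); rewrite sqr_normcE /= lerDr sqr_ge0.
pose Phi x := \sum_i normc (p i).@[v^~ x] ^+ 2.
(* [S] is empty only for [n = 0], where any positive constant will do. *)
have [S0|S0] := pselect (S = classical_sets.set0).
  by exists 1 => // u u1 uj; have := wS u u1 uj; rewrite S0.
have cPhi : continuous Phi.
  apply: continuous_sum_sqr_normc => i; exact: ccontinuous_meval.
have /classical_sets.set0P {}S0 : S != classical_sets.set0 by apply/eqP.
have [x /set_mem xS xmin] :=
  EVT_min_rV S0 compactS (continuous_subspaceT cPhi).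
have Phi_ge0 y : 0 <= Phi y by apply: sumr_ge0 => i _; exact: sqr_ge0.
exists (Phi x); last first.
  move=> u u1 uj; have /mem_set/xmin := wS u u1 uj.
  by rewrite /Phi; under [in leRHS]eq_bigr do rewrite (meval_eq _ (vw u)).
(* A zero minimum would be a common zero of the [p i], hence the origin, which [S] excludes. *)
rewrite lt_neqAle Phi_ge0 andbT eq_sym; apply/negP => /eqP Phi0.
have vx0 : forall j, v j x = 0.
  apply: pz => i; apply/eqP; rewrite -normc_eq0 -sqrf_eq0; apply/eqP.
  by apply: (psumr_eq0P _ Phi0) => // k _; exact: sqr_ge0.
have [_] := xS; rewrite /mkset big1 ?ler10 // => j _.
by rewrite vx0 normc0 expr0n.
Qed.

(** * Uniqueness of the critical point *)

Lemma normc_weighted_homog (R : realType) n (d : 'I_n -> nat) D e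
    (p : {mpoly R[i][n]}) (s : R) (u z : 'I_n -> R[i]) :
  weighted_homog d D e p -> 0 < s -> (forall i, z i = s%:C ^+ d i * u i) ->
  normc p.@[z] * s ^+ e = s ^+ D * normc p.@[u].
Proof.
move=> /weighted_homog_meval ph s0 zu; have := congr1 (@normc R) (ph s%:C u).
rewrite !normcM !normcX normc_real gtr0_norm // => <-.
by rewrite (meval_eq _ zu).
Qed.

(** Weighted scaling preserves critical points. As [z0] may a priori differ from the origin, there
    are two cases: the scaling curve of [z0] itself, starting from [s0 = 1], or, if [z0] is the
    origin, the curve of [u], starting from [s0 = 0]. *)
Lemma isolated_critical_point_unique (R : realType) n (d : 'I_n -> nat) D
    (f : {mpoly R[i][n]}) (z0 : 'rV[R[i]]_n) :
  (forall i, 0 < d i)%N -> weighted_homog d D 0 f ->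
  isolated_critical_point f z0 ->
  forall u, (forall i, (f^`M(i)).@[u] = 0) -> forall j, u j = 0.
Proof.
move=> d0 fh [z0crit [r r0 isol]] u ucrit j; apply/eqP/negPn/negP => uj.
(* The curve s |-> s^d w consists of critical points and reaches z0 at s = s0. *)
have [w [s0 [wcrit [k wk] s0_ge0 z0w]]] :
    exists w (s0 : R), [/\ forall i, (f^`M(i)).@[w] = 0, exists k, w k != 0,
      0 <= s0 & forall i, z0 0 i = s0%:C ^+ d i * w i].
  have [[k zk]|z00] := pselect (exists k, z0 0 k != 0).
    exists (z0 0), 1; split=> //; first by exists k.
    by move=> i; rewrite expr1n mul1r.
  exists u, 0; split=> //; first by exists j.
  move=> i; rewrite expr0n gtn_eqF // mul0r; apply/eqP/negPn/negP => zi.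
  by apply: z00; exists i.
pose zs (s : R) : 'rV[R[i]]_n := \row_i (s%:C ^+ d i * w i).
(* The squared distance from [zs s] to [z0] is a polynomial in [s] vanishing at [s0], so it is small
   near [s0] by continuity. *)
pose P : {poly R} := \sum_i ('X^(d i) - (s0 ^+ d i)%:P) ^+ 2 * (normc (w i) ^+ 2)%:P.
have PE s : P.[s] = \sum_i (s ^+ d i - s0 ^+ d i) ^+ 2 * normc (w i) ^+ 2.
  by rewrite horner_sum; apply: eq_bigr => i _; rewrite !hornerE.
have dist s : enorm (zs s - z0) = Num.sqrt P.[s].
  rewrite PE; congr (Num.sqrt _); apply: eq_bigr => i _.
  rewrite !mxE z0w -mulrBl -!rmorphXn -rmorphB normcM normc_real exprMn.
  by rewrite real_normK ?num_real.
have [s s0s Ps] : exists2 s, s0 < s & P.[s] < r ^+ 2.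
  have Pr : \forall s \near at_right s0, P.[s] < r ^+ 2.
    apply: cvgr_lt (cvg_at_right_filter (@continuous_horner _ P s0)) _ _.
    rewrite PE big1 ?exprn_gt0 // => i _.
    by rewrite subrr expr0n mul0r.
  near (at_right s0) => s; exists s; near: s => //.
  exact: nbhs_right_gt.
have s_gt0 : 0 < s := le_lt_trans s0_ge0 s0s.
apply: (isol (zs s)).
  rewrite dist sqrtr_gt0 -[r](ger0_norm (ltW r0)) -sqrtr_sqr ltr_sqrt ?exprn_gt0 //.
  (* The distance is positive because [w k] is nonzero and [s ^+ d k] exceeds [s0 ^+ d k]. *)
  rewrite Ps andbT PE (bigD1 k) //= ltr_pwDl //.
    rewrite mulr_gt0 // exprn_even_gt0 //=.
      by rewrite subr_eq0 gt_eqF // ltrXn2r // -lt0n.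
    by rewrite normc_eq0.
  by apply: sumr_ge0 => i _; rewrite mulr_ge0 ?sqr_ge0.
move=> i; apply/eqP; rewrite -normc_eq0.
have := normc_weighted_homog (weighted_homog_mderiv (i := i) fh) s_gt0
  (fun i => mxE _ _ 0 i : zs s 0 i = _).
rewrite wcrit normc0 mulr0 => /eqP; rewrite mulf_eq0 => /orP[//|].
by rewrite expf_eq0 (gt_eqF s_gt0) andbF.
Unshelve. all: by end_near.
Qed.

(** * Tensor norms and growth of the derivatives *)

Lemma cometric_mxE (R : realType) n i j :
  cometric_mx R n i j = 2 *+ (i == j).
Proof.
suff -> : cometric_mx R n = 2%:M by rewrite mxE.
rewrite /cometric_mx (_ : metric_mx R n = (2^-1)%:M) ?invmx_scalar ?invrK //.
apply/matrixP => {}i {}j; rewrite !mxE /flat_metric (bigD1 i) //= big1 => [|k ki].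
  by rewrite !mxE !eqxx /= mul0r !addr0 mul1r mulr_natr.
by rewrite !mxE (negPf ki) !mul0r addr0.
Qed.

(** The cometric is twice the identity, so only [J = I] contributes, with one factor 2 for each of
    the [k] indices. *)
Lemma tensor_normE (R : realType) n k (T : k.-tuple 'I_n -> R[i]) :
  tensor_norm T = Num.sqrt (2 ^+ k * \sum_I normc (T I) ^+ 2).
Proof.
congr (Num.sqrt _); rewrite -[RHS]/(complex.Re (_%:C)); congr complex.Re.
rewrite rmorphM rmorphXn rmorph_nat rmorph_sum /= mulr_sumr.
apply: eq_bigr => I _; rewrite [LHS](bigD1 I) //= [X in _ + X]big1 ?addr0 => [|J JI].
  under eq_bigr do rewrite cometric_mxE eqxx mulr1n.
  rewrite prodr_const card_ord -mulrA; congr (_ * _).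
  by rewrite -sqr_normc normc_def sqr_normcE -rmorphXn /= sqr_sqrtr ?addr_ge0 ?sqr_ge0.
have [a aIJ] : exists a, tnth I a != tnth J a.
  apply/existsP; rewrite -negb_forall; apply: contra JI => /forallP IJ.
  by apply/eqP/eq_from_tnth => a; rewrite (eqP (IJ a)).
by rewrite (bigD1 a) //= cometric_mxE (negPf aIJ) mulr0n !mul0r.
Qed.

Lemma at_infinity_filter (R : realType) n : Filter (@at_infinity R n).
Proof.
apply: filter_from_filter; first by exists 0.
by move=> a b _ _; exists (Num.max a b) => // z; rewrite /= gt_max => /andP.
Qed.

Lemma nabla1_norm (R : realType) n (f : {mpoly R[i][n]}) (z : 'rV[R[i]]_n) :
  tensor_norm (@nabla _ _ 1 f z) =
  Num.sqrt (2 * \sum_i normc (f^`M(i)).@[z 0] ^+ 2).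
Proof.
rewrite tensor_normE expr1; congr (Num.sqrt (2 * _)).
rewrite (reindex (fun i : 'I_n => [tuple i])) //=.
exists (fun I => tnth I ord0) => [i|I] _ /=; first by rewrite (tnth_nth i).
by apply: eq_from_tnth => a; rewrite (ord1 a) [LHS](tnth_nth (tnth I ord0)).
Qed.

(** Homogeneity gives $|\partial_if(z)|\,s^{d_i}=s^{2E}|\partial_if(u)|$. Since $d_i\le E$ and
    $s\ge1$, each partial derivative is at least $s^E|\partial_if(u)|$ in modulus, and compactness
    bounds the sum of the squares at [u] from below. *)
Lemma gradient_lower_bound (R : realType) n (d : 'I_n -> nat) E
    (f : {mpoly R[i][n]}) :
  (forall i, d i <= E)%N -> weighted_homog d (2 * E) 0 f ->
  (forall u, (forall i, (f^`M(i)).@[u] = 0) -> forall j, u j = 0) ->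
  exists2 c : R, 0 < c & forall s u (z : 'rV[R[i]]_n), 1 <= s ->
    (forall i, z 0 i = s%:C ^+ d i * u i) ->
    (forall i, normc (u i) <= 1) -> (exists i, normc (u i) = 1) ->
    s ^+ E * c <= tensor_norm (@nabla _ _ 1 f z).
Proof.
move=> dE fh crit0; have [c c0 cP] := common_zero_lower_bound crit0.
exists (Num.sqrt c); first by rewrite sqrtr_gt0.
move=> s u z s1 zu u1 uj; have s0 : 0 < s := lt_le_trans ltr01 s1.
rewrite nabla1_norm -[s ^+ E]ger0_norm ?exprn_ge0 ?(ltW s0) // -sqrtr_sqr.
rewrite -sqrtrM ?sqr_ge0 // ler_wsqrtr //.
have sum_ge0 : 0 <= \sum_i normc (f^`M(i)).@[z 0] ^+ 2.
  by apply: sumr_ge0 => i _; exact: sqr_ge0.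
apply: (@le_trans _ _ (\sum_i normc (f^`M(i)).@[z 0] ^+ 2)); last first.
  by rewrite ler_peMl // ler1n.
apply: le_trans (ler_wpM2l (sqr_ge0 _) (cP u u1 uj)) _.
rewrite mulr_sumr; apply: ler_sum => i _; rewrite -exprMn.
rewrite lerXn2r ?nnegrE ?mulr_ge0 ?exprn_ge0 ?normc_ge0 ?(ltW s0) //.
have sE : 0 < s ^+ E by rewrite exprn_gt0.
rewrite -(ler_pM2r sE) mulrAC -exprD addnn -mul2n.
rewrite -(normc_weighted_homog (weighted_homog_mderiv (i := i) fh) s0 zu) add0n.
by rewrite ler_wpM2l ?normc_ge0 // ler_weXn2l.
Qed.

(** Each derivation lowers the weighted degree by at least 1, so one derivation already gains a
    factor [s]; the values at [u] are bounded on the polydisc. *)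
Lemma nabla_upper_bound (R : realType) n (d : 'I_n -> nat) D
    (f : {mpoly R[i][n]}) k :
  (forall i, 0 < d i)%N -> weighted_homog d D 0 f -> (0 < k)%N ->
  exists C : R, forall s u (z : 'rV[R[i]]_n), 1 <= s ->
    (forall i, z 0 i = s%:C ^+ d i * u i) ->
    (forall i, normc (u i) <= 1) ->
    tensor_norm (@nabla _ _ k f z) * s <= s ^+ D * C.
Proof.
move=> d0 fh k0.
have [C CP] := choice (fun I : k.-tuple 'I_n => meval_bound (foldr (@mderiv n R[i]) f I)).
exists (Num.sqrt (2 ^+ k * \sum_I C I ^+ 2)) => s u z s1 zu u1.
have s0 : 0 < s := lt_le_trans ltr01 s1.
rewrite tensor_normE -[X in _ * X <= _]ger0_norm ?(ltW s0) //.
rewrite -[s ^+ D]ger0_norm ?exprn_ge0 ?(ltW s0) // -!sqrtr_sqr.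
rewrite mulrC -!sqrtrM ?sqr_ge0 // ler_wsqrtr // mulrCA [leRHS]mulrCA.
rewrite ler_wpM2l ?exprn_ge0 // !mulr_sumr; apply: ler_sum => I _.
rewrite -!exprMn.
have CI : normc (foldr (@mderiv n R[i]) f I).@[u] <= C I := CP I u u1.
have CI0 : 0 <= C I := le_trans (normc_ge0 _) CI.
rewrite lerXn2r ?nnegrE ?mulr_ge0 ?exprn_ge0 ?normc_ge0 ?(ltW s0) //.
have := normc_weighted_homog (weighted_homog_mderivs (I := I) fh) s0 zu.
rewrite add0n => h.
apply: le_trans (ler_wpM2l (exprn_ge0 D (ltW s0)) CI); rewrite -h mulrC.
rewrite ler_wpM2l ?normc_ge0 // -[leLHS]expr1 ler_weXn2l //.
(* As [k] is positive, the first index alone makes the total drop in degree at least 1. *)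
case: k I {C CP CI CI0 h} k0 => // k I _.
by rewrite big_tuple (bigD1 ord0) //= (leq_trans (d0 (tnth I ord0))) ?leq_addr.
Qed.

(** * Comparison of the two growth rates at infinity *)

Theorem theorem2p15 (R : realType) (n : nat) (f : {mpoly R[i][n]})
    (q : 'I_n -> rat)
    (hq : quasi_homogeneous q f)
    (hcrit : exists z0 : 'rV[R[i]]_n, isolated_critical_point f z0)
    (hq2 : forall i : 'I_n, q i <= 2^-1) :
  strongly_elliptic f.
Proof.
have q0 i : 0 < q i by have /andP[] := hq.1 i.
have [E [d [E0 dE qd]]] := common_even_denominator q0 hq2.
have fh := quasi_homogeneous_weighted qd hq.
have d0 i : (0 < d i)%N by have /andP[] := dE i.
have {}dE i : (d i <= E)%N by have /andP[] := dE i.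
have [z0 /(isolated_critical_point_unique d0 fh) crit0] := hcrit.
have [c c0 cP] := gradient_lower_bound dE fh crit0.
move=> eps eps0 k k2.
have [C CP] := nabla_upper_bound d0 fh (ltnW k2).
have FF := at_infinity_filter R n.
apply/cvgryPge => A.
have ec0 : 0 < eps * c ^+ k by rewrite mulr_gt0 // exprn_gt0.
(* For [s > s0] this gives $s\,\epsilon c^k-C\ge|A|$. *)
pose s0 := Num.max 1 ((`|A| + C) / (eps * c ^+ k)).
(* The radius is the norm of a vector with all coordinates equal to [s0 ^+ E]. A scale $s\le s_0$
   would give $|z_i|\le s^{d_i}\le s_0^E$ for every $i$, so outside this radius $s>s_0$. *)
exists (Num.sqrt (\sum_(i < n) (s0 ^+ E) ^+ 2)) => // z /= zM.
have s01 : 1 <= s0 by rewrite le_max lexx.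
have z_neq0 : exists i, z 0 i != 0.
  apply: contrapT => nz; move: zM; apply/negP; rewrite -leNgt.
  apply: ler_wsqrtr; apply: ler_sum => i _.
  have -> : z 0 i = 0 by apply/eqP/negPn/negP => zi; apply: nz; exists i.
  by rewrite normc0 expr0n sqr_ge0.
have [s [u [s_gt0 zu u1 uj]]] := weighted_scaling d0 z_neq0.
have ss0 : s0 < s.
  rewrite ltNge; apply/negP => ss0; move: zM; apply/negP; rewrite -leNgt.
  apply: ler_wsqrtr; apply: ler_sum => i _.
  have s0_ge0 : 0 <= s0 := le_trans ler01 s01.
  rewrite lerXn2r ?nnegrE ?normc_ge0 ?exprn_ge0 //.
  rewrite zu normcM normcX normc_real gtr0_norm //.
  apply: le_trans (_ : s ^+ d i <= _).
    by rewrite ler_piMr ?exprn_ge0 // ltW.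
  apply: (@le_trans _ _ (s0 ^+ d i)); last by rewrite ler_weXn2l.
  by rewrite lerXn2r ?nnegrE // ltW.
have s1 : 1 <= s := le_trans s01 (ltW ss0).
have s_ge0 := ltW s_gt0.
have grad : s ^+ (2 * E) * (eps * c ^+ k) <= eps * tensor_norm (@nabla _ _ 1 f z) ^+ k.
  rewrite mulrCA ler_wpM2l ?(ltW eps0) //.
  (* Here $k\ge2$ enters: $s^{kE}\ge s^{2E}$ for $s\ge1$. *)
  apply: (@le_trans _ _ ((s ^+ E * c) ^+ k)).
    rewrite exprMn -exprM ler_wpM2r ?exprn_ge0 ?(ltW c0) //.
    by rewrite ler_weXn2l // mulnC leq_mul2l k2 orbT.
  rewrite lerXn2r ?nnegrE ?mulr_ge0 ?exprn_ge0 ?(ltW c0) ?sqrtr_ge0 //.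
  exact: cP zu u1 uj.
have sE : s ^+ (2 * E) = s ^+ (2 * E).-1 * s.
  by rewrite -exprSr prednK // muln_gt0.
have hess : tensor_norm (@nabla _ _ k f z) <= s ^+ (2 * E).-1 * C.
  have := CP s u z s1 zu u1; rewrite sE mulrAC.
  by rewrite ler_pM2r.
(* Factoring out $s^{2E-1}\ge1$ leaves $s\,\epsilon c^k-C$, which is at least $|A|\ge0$. *)
apply: le_trans (lerB grad hess); rewrite sE -mulrA -mulrBr.
have As : `|A| <= s * (eps * c ^+ k) - C.
  rewrite lerBrDr -ler_pdivrMr //; apply: le_trans (ltW ss0).
  by rewrite le_max lexx orbT.
apply: le_trans (ler_norm A) _; apply: (le_trans As).
rewrite ler_peMl ?exprn_ege1 //.
exact: le_trans (normr_ge0 A) As.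
Qed.
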